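(* Let $PG_n$ be the undirected, unweighted path-graph on the vertex set $\{1,\dots,n\}$, $n\ge1$. For $q>0$ its partition function satisfies $$Z_{PG_n}(q)=\sum_{k=1}^{n}\binom{n+k-1}{2k-1}q^{k}=\prod_{k=1}^{n}\left(q+2-2\cos\left(\tfrac{\pi(n-k)}{n}\right)\right)$$ $$=\frac{q\left(q+2+\sqrt{q^2+4q}\right)^{n}-q\left(q+2-\sqrt{q^2+4q}\right)^{n}}{2^{n}\sqrt{q^2+4q}}=q\,\mathcal U_{n-1}\left(\tfrac q2+1\right),$$ where $\mathcal U_{n-1}$ denotes the Chebyshev polynomial of the second kind of degree $n-1$.
   Context: $PG_n$ has edges between $i$ and $i+1$ for $1\le i\le n-1$, each considered as two directed edges $(i,i+1)$ and $(i+1,i)$ of weight $1$. A rooted spanning forest of a finite directed graph is a subset $F$ of its directed edges such that each vertex has at most one outgoing edge in $F$ and $F$ contains no directed cycle; its roots are the vertices without outgoing edge in $F$ and $r(F)$ is the number of roots. The partition function of a graph $G$ with all edge weights $1$ is $Z_G(q)=\sum_F q^{r(F)}$, the sum running over all rooted spanning forests of $G$; equivalently $Z_G(q)=\det[qI-L]$ with $L=A-D$, where $A$ is the adjacency matrix and $D$ the diagonal degree matrix. *)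

(* Defs.v *)
From mathcomp Require Import all_boot all_order all_algebra.
From mathcomp Require Import boolp reals trigo.

Set Implicit Arguments.
Unset Strict Implicit.
Unset Printing Implicit Defensive.

Import Order.TTheory GRing.Theory Num.Theory.

Local Open Scope ring_scope.

Section RootedForests.
Variable T : finType.
Implicit Types (E F : {set T * T}) (x : T).

Definition out_edges F x : {set T * T} := [set e in F | e.1 == x].

(* Cycles of length 1 (loops) and of length 2 (an edge together with its
   reversal) are excluded too. *)
Definition no_directed_cycle F : Prop :=
  forall c : seq T, c != [::] -> ~ ucycle (fun x y => (x, y) \in F) c.

Definition rooted_spanning_forest E F : Prop :=
  [/\ F \subset E,
      forall x, (#|out_edges F x| <= 1)%N
    & no_directed_cycle F].

Definition roots F : {set T} := [set x | out_edges F x == set0].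

Definition partition_function (R : realType) E (q : R) : R :=
  \sum_(F : {set T * T} | `[< rooted_spanning_forest E F >]) q ^+ #|roots F|.

End RootedForests.

(* The vertex i of the path on {1, ..., n} is the ordinal i - 1. *)
Definition path_graph (n : nat) : {set 'I_n * 'I_n} :=
  [set e : 'I_n * 'I_n |
     (e.2 == e.1.+1 :> nat) || (e.1 == e.2.+1 :> nat)].

(* The pair (U_n, U_{n+1}), from U_0 = 1, U_1 = 2X and
   U_{n+2} = 2X U_{n+1} - U_n. *)
Fixpoint chebyshevU_pair (R : realType) (n : nat) : {poly R} * {poly R} :=
  if n is m.+1 then
    let: (u, v) := chebyshevU_pair R m in (v, 2%:R *: 'X * v - u)
  else (1, 2%:R *: 'X).

Definition chebyshevU (R : realType) (n : nat) : {poly R} :=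
  (chebyshevU_pair R n).1.

(* Main.v *)
Require Import Defs.
From mathcomp Require Import all_boot all_order all_algebra.
From mathcomp Require Import boolp reals trigo.
From mathcomp Require Import ring zify.

Set Implicit Arguments.
Unset Strict Implicit.
Unset Printing Implicit Defensive.

Import Order.TTheory GRing.Theory Num.Theory.

Local Open Scope ring_scope.

(** A subset [F] of the directed edges of the path in which every vertex has at
    most one outgoing edge is a word with one letter per vertex: the vertex is
    a root, or its edge goes up to the next vertex, or down to the previous
    one.  A directed cycle in the path must turn back at its largest vertex, so
    acyclicity only forbids a letter up immediately followed by a letter down.
    The two ends of the path obey the same rule if one adds a virtual letter up
    before the first vertex and a virtual letter down after the last: no edge
    leaves the path.  Hence [partition_function_path]: the partition function
    is the sum of [q ^ (number of roots)] over the words that avoid the factor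
    up-down between these two sentinels.

    Such sums are computed by a transfer matrix that reads the word letter by
    letter.  If [a n] and [b n] are the sums over words of length [n] that
    follow a root (or a down) and an up, respectively, then
    [a (n+1) = a n + b (n+1)] and [b (n+1) = q * a n + b n].  The partition
    function is [b n], and every formula follows from this system.
    - The system is Pascal's rule twice, which gives the binomial sum.
    - The matrix has trace [q + 2] and determinant 1, so that
      [b (n+2) = (q+2) b (n+1) - b n]; with [2 x = q + 2] this is the Chebyshev
      recurrence.
    - The same recurrence is solved by the powers of the two eigenvalues
      [(q + 2 +- sqrt (q ^ 2 + 4 q)) / 2].
    - The identity [U_m (cos t) sin t = sin ((m+1) t)] exhibits [m] distinct
      roots of [U_m], which therefore factors over them. *)

(** * Words without a clash *)

(** The letter of a vertex records its outgoing edge; [None] marks a root. *)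
Local Notation up := (Some true).
Local Notation down := (Some false).

Definition no_clash (x y : option bool) : bool :=
  ~~ ((x == up) && (y == down)).

(** The letter [x] stands before the word and a sentinel [down] after it; with
    [x = up] both ends of the path are guarded by the clash rule itself. *)
Definition admissible (x : option bool) (s : seq (option bool)) : bool :=
  path no_clash x (rcons s down).

(** The clash rule at the two sentinels says that no edge leaves the path at
    its ends; elsewhere it forbids two opposite edges between neighbours. *)
Lemma admissibleP n (w : n.-tuple (option bool)) (hn : (0 < n)%N) :
  reflect [/\ forall i : 'I_n, tnth w i = up -> (i.+1 < n)%N,
              forall i : 'I_n, tnth w i = down -> (0 < i)%N
            & forall i j : 'I_n, j = i.+1 :> nat ->
                tnth w i = up -> tnth w j <> down]
          (admissible up w).
Proof.
have sz : size (rcons w down) = n.+1 by rewrite size_rcons size_tuple.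
have nthE (i : 'I_n) : nth None (rcons w down) i = tnth w i.
  by rewrite nth_rcons size_tuple ltn_ord (tnth_nth None).
have nth_end : nth None (rcons w down) n = down.
  by rewrite nth_rcons size_tuple ltnn eqxx.
apply: (iffP (pathP None)) => [| [last_ok first_ok ok] [|i]]; rewrite sz.
- move=> ok; split=> [i wi | i wi | i j ij wi wj].
  + rewrite ltn_neqAle ltn_ord andbT; apply/eqP => iN.
    have := ok i.+1; rewrite /= nthE wi iN nth_end ltnSn.
    by move=> /(_ isT).
  + case: i wi => [[|i] lt_in] // wi.
    have := ok 0%N isT; rewrite /= -[0%N]/(nat_of_ord (Ordinal lt_in)).
    by rewrite nthE wi.
  + have := ok j (ltn_trans (ltn_ord j) (ltnSn n)).
    by rewrite nthE wj ij /= nthE wi.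
- move=> _ /=; rewrite -[0%N]/(nat_of_ord (Ordinal hn)) nthE.
  by apply/negP => /andP[_ /eqP/first_ok].
- rewrite ltnS => lt_in /=; rewrite -[i in X in no_clash X]/(nat_of_ord (Ordinal lt_in)).
  rewrite nthE; apply/negP => /andP[/eqP wi /eqP wi1].
  have lt_i1n := last_ok _ wi.
  apply: (ok (Ordinal lt_in) (Ordinal lt_i1n)) => //.
  by rewrite -nthE.
Qed.

(** * Forests of the path as words *)

Section ForestWords.
Variable n : nat.
Implicit Types (w : n.-tuple (option bool)) (F : {set 'I_n * 'I_n}).

Definition forest_of_word w : {set 'I_n * 'I_n} :=
  [set e : 'I_n * 'I_n |
     (tnth w e.1 == up) && (e.2 == e.1.+1 :> nat)
     || (tnth w e.1 == down) && (e.1 == e.2.+1 :> nat)].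

Definition word_of_forest F : n.-tuple (option bool) :=
  [tuple if [exists j, ((i, j) \in F) && (j == i.+1 :> nat)] then up
         else if [exists j, ((i, j) \in F) && (i == j.+1 :> nat)] then down
         else None | i < n].

(** Since a vertex has at most one outgoing edge, the letter that records one
    edge has recorded all of them. *)
Lemma word_of_forestK F :
    F \subset path_graph n -> (forall x, #|out_edges F x| <= 1)%N ->
  forest_of_word (word_of_forest F) = F.
Proof.
move=> /subsetP sFE out1; apply/setP => -[i j]; rewrite inE /= tnth_mktuple.
have uniq_out j1 j2 : (i, j1) \in F -> (i, j2) \in F -> j1 = j2.
  move=> Fj1 Fj2; have /card_le1_eqP/(_ (i, j1) (i, j2)) := out1 i.
  by rewrite !inE /= Fj1 Fj2 eqxx => /(_ isT isT)[].
case: ifPn => [/existsP[k /andP[Fk /eqP kE]] | /existsPn no_up].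
  rewrite eqxx /= orbF; apply/eqP/idP => [jE | /uniq_out/(_ Fk) -> //].
  by have -> : j = k by apply: val_inj; rewrite /= kE.
case: ifPn => [/existsP[k /andP[Fk /eqP kE]] | /existsPn no_down].
  rewrite /=; apply/eqP/idP => [jE | /uniq_out/(_ Fk) -> //].
  by have -> : j = k by apply: val_inj; move: jE; rewrite /= kE => -[].
apply/esym/negP => Fij; have := no_up j; have := no_down j.
by have := sFE _ Fij; rewrite inE /= Fij /= => /orP[] ->.
Qed.

(** A letter that points out of the path would produce no edge and be read back
    as a root; admissibility excludes it. *)
Lemma forest_of_wordK w (hn : (0 < n)%N) :
  admissible up w -> word_of_forest (forest_of_word w) = w.
Proof.
move=> /(admissibleP _ hn)[last_ok first_ok _].
apply: eq_from_tnth => i; rewrite tnth_mktuple.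
case: ifPn => [/existsP[j] | /existsPn no_up].
  rewrite inE /= => /andP[/orP[] /andP[/eqP wi /eqP ijE] /eqP jiE] //.
  by lia.
case: ifPn => [/existsP[j] | /existsPn no_down].
  rewrite inE /= => /andP[/orP[] /andP[/eqP wi /eqP ijE] /eqP jiE] //.
  by lia.
case wi: (tnth w i) => [[]|//].
  by have := no_up (Ordinal (last_ok i wi)); rewrite inE /= wi !eqxx.
have i_gt0 := first_ok i wi.
have lt_i1n : (i.-1 < n)%N by rewrite (leq_ltn_trans (leq_pred _)).
by have := no_down (Ordinal lt_i1n); rewrite inE /= wi (prednK i_gt0) !eqxx.
Qed.

(** At its largest vertex [v] a cycle comes from [v - 1] and returns to
    [v - 1]: the letters of [v - 1] and [v] clash. *)
Lemma forest_of_word_acyclic w (hn : (0 < n)%N) :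
  admissible up w -> no_directed_cycle (forest_of_word w).
Proof.
move=> /(admissibleP _ hn)[_ _ ok] [//|x0 c] _ /andP[cyc _].
have c0 : x0 \in x0 :: c by rewrite mem_head.
case: (arg_maxnP (fun x : 'I_n => x : nat) c0) => v cv max_v.
have := next_cycle cyc cv; have := prev_cycle cyc cv.
have := max_v _ (etrans (mem_next (x0 :: c) v) cv).
have := max_v _ (etrans (mem_prev (x0 :: c) v) cv).
move: (prev _ v) (next _ v) => a b; rewrite !inE /= => le_av le_bv.
case/orP => /andP[/eqP wa /eqP vaE]; last by lia.
case/orP => /andP[/eqP wv /eqP bvE]; first by lia.
exact: ok vaE wa wv.
Qed.

(** The condition left by reindexing the sum over forests along
    [forest_of_word].  The round trip detects letters that point out of the
    path; a clash inside the word is a directed cycle of length 2. *)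
Lemma forest_of_word_rooted w (hn : (0 < n)%N) :
  rooted_spanning_forest (path_graph n) (forest_of_word w) /\
    word_of_forest (forest_of_word w) = w <-> admissible up w.
Proof.
split=> [[[_ _ acyc] wK] | ok]; last first.
  split; last exact: forest_of_wordK.
  split; last exact: forest_of_word_acyclic.
  - apply/subsetP => -[i j]; rewrite !inE /=.
    by case/orP => /andP[_ ->]; rewrite ?orbT.
  - move=> x; apply/card_le1_eqP => -[i j] [i' j'].
    rewrite !inE /= => /andP[ei /eqP ix] /andP[ei' /eqP i'x].
    congr (_, _); first by rewrite ix i'x.
    apply: val_inj => /=; move: ei ei'; rewrite ix i'x.
    by case: (tnth w _) => [[]|] //=; rewrite ?orbF => /eqP + /eqP; lia.
have wE i := congr1 (fun u => tnth u i) wK.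
apply/(admissibleP _ hn); split=> [i wi | i wi | i j ij wi wj].
- move: (wE i); rewrite tnth_mktuple wi.
  case: ifPn => [/existsP[j /andP[_ /eqP <-]] // | _].
  by case: ifP.
- move: (wE i); rewrite tnth_mktuple wi.
  case: ifPn => // _; case: ifPn => // /existsP[j /andP[_ /eqP ->]] //.
- apply: (acyc [:: i; j]) => //; rewrite /ucycle /= !inE /= wi wj ij !eqxx /=.
  by rewrite -val_eqE /= ij; apply/andP; split => //; lia.
Qed.

Lemma card_roots_forest_of_word w (hn : (0 < n)%N) :
  admissible up w -> #|Defs.roots (forest_of_word w)| = count_mem None w.
Proof.
move=> /[dup] ok /(admissibleP _ hn)[last_ok first_ok _].
rewrite -[in RHS](map_tnth_enum w) count_map cardE -size_filter enumT.
congr size; apply: eq_filter => i /=.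
rewrite !inE; apply/eqP/eqP => [no_out | wi]; last first.
  apply/setP => -[j k]; rewrite !inE /=.
  by case: (j =P i) => [->|_]; rewrite ?andbF // wi.
case wi: (tnth w i) => [[]|//].
  have /setP/(_ (i, Ordinal (last_ok i wi))) := no_out.
  by rewrite !inE /= wi !eqxx.
have i_gt0 := first_ok i wi.
have lt_i1n : (i.-1 < n)%N by rewrite (leq_ltn_trans (leq_pred _)).
have /setP/(_ (i, Ordinal lt_i1n)) := no_out.
by rewrite !inE /= wi (prednK i_gt0) !eqxx.
Qed.

End ForestWords.

(** * The transfer matrix *)

Section Transfer.
Variables (R : comNzRingType) (q : R).

Definition word_sum n (x : option bool) : R :=
  \sum_(w : n.-tuple (option bool) | admissible x w) q ^+ count_mem None w.

Lemma word_sum0 x : word_sum 0 x = (x != up)%:R.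
Proof.
rewrite /word_sum big_mkcond (big_pred1 [tuple]) /=; last first.
  by move=> w; rewrite [w]tuple0 /= eqxx.
by rewrite /admissible /= /no_clash andbT expr0 andbT; case: (x == up).
Qed.

(** Removing the first letter: it weighs [q] if it is a root and 1 otherwise,
    and it becomes the letter before the rest of the word. *)
Lemma word_sumS n x :
  word_sum n.+1 x
    = q * word_sum n None + word_sum n up + (x != up)%:R * word_sum n down.
Proof.
rewrite /word_sum.
rewrite (reindex (fun yw : option bool * n.-tuple (option bool) =>
                    cons_tuple yw.1 yw.2)) /=; last first.
  exists (fun w => (thead w, behead_tuple w)) => [[y w] _ | w _] /=.
    by congr (_, _); apply: val_inj.
  by rewrite [RHS]tuple_eta; apply: val_inj.
rewrite (eq_bigl (fun yw : _ * n.-tuple _ =>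
                    no_clash x yw.1 && admissible yw.1 yw.2)) //.
rewrite -(pair_big_dep (no_clash x) (fun y (w : n.-tuple _) => admissible y w)
           (fun y (w : n.-tuple _) => q ^+ ((y == None) + count_mem None w))) /=.
rewrite big_mkcond (bigD1 None) // (bigD1 up) //= (big_pred1 down) /=; last first.
  by case=> [[]|].
rewrite /no_clash !andbF andbT addrA /=; congr (_ + _ + _).
  by rewrite mulr_sumr; apply: eq_bigr => w _; rewrite -exprS.
by case: (x == up); rewrite ?mul0r ?mul1r.
Qed.

Lemma word_sum_down n : word_sum n down = word_sum n None.
Proof. by case: n => [|n]; rewrite ?word_sum0 ?word_sumS. Qed.

(** As [None] and [down] put the same constraint on what follows, two states
    remain and the system is 2 by 2. *)
Lemma word_sumS_None n :
  word_sum n.+1 None = word_sum n None + word_sum n.+1 up.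
Proof. by rewrite !word_sumS word_sum_down /=; ring. Qed.

Lemma word_sumS_up n :
  word_sum n.+1 up = q * word_sum n None + word_sum n up.
Proof. by rewrite word_sumS eqxx mul0r addr0. Qed.

(** Cayley-Hamilton for the transfer matrix. *)
Lemma word_sumSS_up n :
  word_sum n.+2 up = (q + 2) * word_sum n.+1 up - word_sum n up.
Proof. by rewrite word_sumS_up word_sumS_None word_sumS_up; ring. Qed.

(** Both steps of the system are Pascal's rule on coefficients.  The upper bound
    [N] is left free because the two sums have different numbers of nonzero
    terms, while Pascal's rule needs a common range. *)
Lemma word_sum_binomial n :
  (forall N, (n < N)%N ->
     word_sum n None = \sum_(k < N) 'C(n + k, 2 * k)%:R * q ^+ k) /\
  (forall N, (n <= N)%N ->
     word_sum n up = \sum_(k < N) 'C(n + k, (2 * k).+1)%:R * q ^+ k.+1).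
Proof.
elim: n => [|n [IHN IHu]].
  split=> N hN; rewrite word_sum0 /=.
    case: N hN => // N _; rewrite big_ord_recl mulr1 big1 ?addr0 // => k _.
    by rewrite bin_small ?mul0r // lift0; lia.
  by rewrite big1 // => k _; rewrite bin_small ?mul0r //; lia.
have up_eq N : (n < N)%N -> word_sum n.+1 up
    = \sum_(k < N) 'C(n.+1 + k, (2 * k).+1)%:R * q ^+ k.+1.
  move=> hN; rewrite word_sumS_up (IHN N) // (IHu N (ltnW hN)).
  rewrite mulr_sumr -big_split; apply: eq_bigr => k _ /=.
  by rewrite addSn binS natrD exprS; ring.
split=> // -[//|N] hN; rewrite word_sumS_None (IHN N.+1 (ltnW hN)) (up_eq N) //.
rewrite !big_ord_recl !addn0 !bin0 -addrA; congr (_ + _).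
rewrite -big_split; apply: eq_bigr => k _ /=.
have -> : bump 0 k = k.+1 by [].
by rewrite mulnSr addn2 !addnS !addSn [in RHS]binS natrD mulrDl.
Qed.

(** The numbers [q + 2 + s] and [q + 2 - s] are twice the eigenvalues of the
    transfer matrix; the factors [2 ^+ n] and [s] clear the denominators. *)
Lemma word_sum_closed_form n s : s ^+ 2 = q ^+ 2 + 4 * q ->
  2 ^+ n * s * word_sum n up = q * (q + 2 + s) ^+ n - q * (q + 2 - s) ^+ n.
Proof.
move=> s2; elim/ltn_ind: n => -[|[|n]] IHn.
- by rewrite word_sum0 !expr0 /=; ring.
- by rewrite word_sumS_up !word_sum0 !expr1 /=; ring.
rewrite word_sumSS_up.
have E0 := IHn n (ltnW (ltnSn _)); have E1 := IHn n.+1 (ltnSn _).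
transitivity (2 * (q + 2) * (2 ^+ n.+1 * s * word_sum n.+1 up)
              - 4 * (2 ^+ n * s * word_sum n up)).
  by rewrite !exprS; ring.
rewrite E0 E1.
(* Both are roots of X^2 - 2 (q + 2) X + 4, which is the recurrence. *)
have root_add : (q + 2 + s) ^+ 2 = 2 * (q + 2) * (q + 2 + s) - 4 by ring: s2.
have root_sub : (q + 2 - s) ^+ 2 = 2 * (q + 2) * (q + 2 - s) - 4 by ring: s2.
have powSS (x : R) : x ^+ n.+2 = x ^+ n * x ^+ 2 by rewrite -exprD addn2.
by rewrite !powSS root_add root_sub !(exprSr _ n); ring.
Qed.

End Transfer.

(** * Factorization of the Chebyshev polynomials *)

Section Chebyshev.
Variable R : realType.

Lemma chebyshevU_pairE n :
  chebyshevU_pair R n = (chebyshevU R n, chebyshevU R n.+1).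
Proof. by rewrite /chebyshevU /=; case: chebyshevU_pair. Qed.

Lemma chebyshevUSS n :
  chebyshevU R n.+2 = 2%:R *: 'X * chebyshevU R n.+1 - chebyshevU R n.
Proof. by rewrite [LHS]/chebyshevU /= chebyshevU_pairE. Qed.

Lemma horner_chebyshevUSS n x :
  (chebyshevU R n.+2).[x] = 2 * x * (chebyshevU R n.+1).[x] - (chebyshevU R n).[x].
Proof. by rewrite chebyshevUSS !hornerE. Qed.

Lemma size_lead_chebyshevU n :
  size (chebyshevU R n) = n.+1 /\ lead_coef (chebyshevU R n) = 2 ^+ n.
Proof.
elim/ltn_ind: n => -[|[|n]] IHn.
- by rewrite /chebyshevU /= size_poly1 lead_coef1.
- rewrite /chebyshevU /= size_scale ?pnatr_eq0 // size_polyX.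
  by rewrite lead_coefZ lead_coefX mulr1.
have [sz0 _] := IHn n (ltnW (ltnSn _)); have [sz1 lc1] := IHn n.+1 (ltnSn _).
have szX : size (2%:R *: 'X * chebyshevU R n.+1) = n.+3.
  by rewrite -scalerAl size_scale ?pnatr_eq0 // mulrC size_mulX -?size_poly_eq0 sz1.
have lt_sz : (size (- chebyshevU R n) < size (2%:R *: 'X * chebyshevU R n.+1)%R)%N.
  by rewrite size_polyN sz0 szX; lia.
rewrite chebyshevUSS size_polyDl // szX lead_coefDl //.
by split=> //; rewrite lead_coefM lead_coefZ lead_coefX lc1 mulr1 [RHS]exprS.
Qed.

Lemma chebyshevU_cos n (t : R) :
  (chebyshevU R n).[cos t] * sin t = sin (n.+1%:R * t).
Proof.
elim/ltn_ind: n => -[|[|n]] IHn.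
- by rewrite /chebyshevU /= hornerE !mul1r.
- by rewrite /chebyshevU /= !hornerE [in RHS]mulr_natl sin_mulr2n; ring.
rewrite horner_chebyshevUSS mulrBl -[_ * _ * sin t]mulrA !IHn //.
have -> : n.+3%:R * t = n.+2%:R * t + t by rewrite [n.+3%:R]mulrSr; ring.
have -> : n.+1%:R * t = n.+2%:R * t - t by rewrite [n.+2%:R]mulrSr; ring.
by rewrite sinB sinD; ring.
Qed.

(** The angles [k pi / (n + 1)], for [k] from 1 to [n], lie inside ]0, pi[, where
    cos is injective and sin does not vanish: [chebyshevU_cos] turns the zeros
    of [sin ((n + 1) t)] into [n] distinct roots, as many as the degree. *)
Lemma chebyshevU_factor n :
  chebyshevU R n
    = 2 ^+ n *: \prod_(1 <= k < n.+1) ('X - (cos (pi * k%:R / n.+1%:R))%:P).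
Proof.
have [szU lcU] := size_lead_chebyshevU n.
pose angle k : R := pi * k%:R / n.+1%:R.
have n1_gt0 : (0 : R) < n.+1%:R by rewrite ltr0n.
have angle_in k : (k \in index_iota 1 n.+1) -> 0 < angle k < pi.
  rewrite mem_index_iota => /andP[k_gt0 lt_kn].
  rewrite /angle divr_gt0 ?mulr_gt0 ?pi_gt0 ?ltr0n //=.
  by rewrite ltr_pdivrMr // ltr_pM2l ?pi_gt0 // ltr_nat.
rewrite -lcU -(big_map (fun k => cos (angle k)) xpredT (fun x => 'X - x%:P)).
apply: all_roots_prod_XsubC.
- by rewrite size_map size_iota szU subn1.
- apply/allP => _ /mapP[k /angle_in k_in ->].
  have sin_neq0 : sin (angle k) != 0 by rewrite gt_eqF // sin_gt0_pi.
  rewrite /root -(inj_eq (mulIf sin_neq0)) mul0r chebyshevU_cos /angle.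
  rewrite mulrC (divfK (lt0r_neq0 n1_gt0)); apply/eqP.
  elim: (k) => [|j IHj]; first by rewrite mulr0 sin0.
  by rewrite mulrS mulrDr mulr1 addrC sinDpi IHj oppr0.
- rewrite uniq_rootsE map_inj_in_uniq ?iota_uniq // => j k.
  move=> /angle_in/andP[j_gt0 lt_jpi] /angle_in/andP[k_gt0 lt_kpi].
  move=> /cos_inj; rewrite !in_itv /= !ltW // => /(_ isT isT).
  move=> /(mulIf (invr_neq0 (lt0r_neq0 n1_gt0)))/(mulfI (lt0r_neq0 (pi_gt0 R))).
  by move=> /eqP; rewrite eqr_nat => /eqP.
Qed.

End Chebyshev.

(** * The partition function of the path *)

Lemma partition_function_path (R : realType) (q : R) n : (0 < n)%N ->
  partition_function (path_graph n) q = word_sum q n up.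
Proof.
move=> hn; rewrite /partition_function.
rewrite (reindex_onto (@forest_of_word n) (@word_of_forest n)); last first.
  by move=> F /asboolP[sFE out1 _]; apply: word_of_forestK.
have adm w : `[< rooted_spanning_forest (path_graph n) (forest_of_word w) >]
    && (word_of_forest (forest_of_word w) == w) = admissible up w.
  apply/andP/idP => [[/asboolP rF /eqP wK] | /forest_of_word_rooted].
    exact/forest_of_word_rooted.
  by move=> /(_ hn)[rF wK]; split; [apply/asboolP | apply/eqP].
rewrite (eq_bigl _ _ adm); apply: eq_bigr => w ok.
by rewrite card_roots_forest_of_word.
Qed.

Lemma word_sum_chebyshevU (R : realType) (q : R) n :
  word_sum q n.+1 up = q * (chebyshevU R n).[q / 2 + 1].
Proof.
have x2 : 2 * (q / 2 + 1) = q + 2 by field.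
elim/ltn_ind: n => -[|[|n]] IHn.
- by rewrite word_sumS_up !word_sum0 /chebyshevU /= !hornerE.
- rewrite word_sumSS_up word_sumS_up !word_sum0 /chebyshevU /= hornerZ hornerX x2.
  by ring.
by rewrite word_sumSS_up IHn // IHn // horner_chebyshevUSS x2; ring.
Qed.

Theorem theorem4 (R : realType) (n : nat) (hn : (1 <= n)%N) (q : R)
    (hq : 0 < q) :
  [/\ partition_function (path_graph n) q
        = \sum_(1 <= k < n.+1) 'C(n + k - 1, 2 * k - 1)%:R * q ^+ k,
      partition_function (path_graph n) q
        = \prod_(1 <= k < n.+1)
            (q + 2 - 2 * cos (pi * (n%:R - k%:R) / n%:R)),
      partition_function (path_graph n) q
        = (q * (q + 2 + Num.sqrt (q ^+ 2 + 4 * q)) ^+ n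
           - q * (q + 2 - Num.sqrt (q ^+ 2 + 4 * q)) ^+ n)
          / (2 ^+ n * Num.sqrt (q ^+ 2 + 4 * q))
    & partition_function (path_graph n) q
        = q * (chebyshevU R n.-1).[q / 2 + 1]].
Proof.
have disc_gt0 : 0 < q ^+ 2 + 4 * q by rewrite addr_gt0 ?exprn_gt0 ?mulr_gt0.
have chebE : word_sum q n up = q * (chebyshevU R n.-1).[q / 2 + 1].
  by rewrite -word_sum_chebyshevU prednK.
rewrite partition_function_path //; split=> //.
- have [_ /(_ n (leqnn n)) ->] := word_sum_binomial q n.
  rewrite big_add1 big_mkord; apply: eq_bigr => k _.
  by rewrite addnS subn1 mulnSr addn2 subn1.
- rewrite chebE; case: n hn {chebE} => // m _ /=.
  rewrite chebyshevU_factor hornerZ horner_prod.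
  (* The factor of index n is q + 2 - 2 cos 0 = q; the others, in reverse
     order, are the linear factors of the Chebyshev polynomial, doubled. *)
  rewrite [RHS]big_nat_recr //= subrr mulr0 mul0r cos0 [RHS]mulrC.
  congr (_ * _); first by ring.
  rewrite [RHS]big_nat_rev /=.
  have -> : (2 : R) ^+ m = \prod_(1 <= k < m.+1) 2.
    by rewrite prodr_const_nat subn1.
  rewrite -big_split; apply: eq_big_nat => k /andP[k_gt0 lt_km] /=.
  rewrite hornerXsubC -natrB; last by lia.
  have -> : (m.+1 - (1 + m.+1 - k.+1) = k)%N by lia.
  by field.
- apply: (canRL (mulfK _)).
    by rewrite mulf_neq0 ?expf_neq0 ?pnatr_eq0 // gt_eqF // sqrtr_gt0.
  by rewrite mulrC word_sum_closed_form // sqr_sqrtr // ltW.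
Qed.
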